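(* Let $q=(u,v,p)$ be a state with constant pressure $p$ (all nodal values equal) and with velocities $u,v$ such that $U_{\alpha;\beta}+V_{\alpha;\beta}=f_\alpha+g_\beta$ for some arrays $f=(f_\alpha)$, $g=(g_\beta)$, or equivalently such that $\Phi^E_{i,s;j,r}=0$ for all cells $E=E_{ij}$ and all $s,r\in\{0,\dots,K\}$. Then $q$ is a steady equilibrium of the GFq-based OSS method, i.e. $(\mathcal E_{\text{C-GFq}}+\mathcal E_{\text{OSS-GFq}})\,q=0$.
   Context: Grid and spaces: $K\ge1$; $\Omega^x=\bigcup_{i=0}^{N_x-1}E^x_i$ with $E_i^x=[x_i,x_{i+1}]$ of equal length $\Delta x$, $\Omega^y=\bigcup_{j=0}^{N_y-1}E^y_j$ with $E_j^y=[y_j,y_{j+1}]$ of equal length $\Delta y$; $E_{ij}=E^x_i\times E^y_j$, $h=\min\{\Delta x,\Delta y\}$. With the Gauss–Lobatto points $0=\xi_0<\dots<\xi_K=1$ of $[0,1]$, set $x_{i,s}=x_i+\xi_s\Delta x$, $y_{j,r}=y_j+\xi_r\Delta y$ (so $x_{i,K}=x_{i+1,0}$), numbered globally as $x_\alpha=x_{i,s}$, $\alpha=iK+s$, $0\le\alpha\le N_xK$, and similarly $y_\beta$. A grid function $w=(w_{\alpha;\beta})$ is identified with $w_h=\sum w_{\alpha;\beta}\varphi^x_\alpha(x)\varphi^y_\beta(y)$, where $\varphi^x_\alpha$ is continuous, of degree $\le K$ on each cell, with $\varphi^x_\alpha(x_{\alpha'})=\delta_{\alpha\alpha'}$ (same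 in $y$). Matrices (no boundary conditions are imposed): $(M_x)_{\alpha\beta}=\int\varphi^x_\alpha\varphi^x_\beta$, $(D_x)_{\alpha\beta}=\int\varphi^x_\alpha\partial_x\varphi^x_\beta$, $(D^x)_{\alpha\beta}=\int\partial_x\varphi^x_\alpha\,\varphi^x_\beta$, $(D^x_x)_{\alpha\beta}=\int\partial_x\varphi^x_\alpha\partial_x\varphi^x_\beta$, all over $\Omega^x$ and evaluated with Gauss–Lobatto quadrature at the nodes (so $M_x$ is diagonal and invertible); same in $y$. Put $Z_x=D^x_x-D^xM_x^{-1}D_x$, $Z_y=D^y_y-D^yM_y^{-1}D_y$. Integrator: $(I_xw)_\alpha=\int_{x_0}^{x_\alpha}w_h\,dx$ with $w_h=\sum_{\alpha'} w_{\alpha'}\varphi^x_{\alpha'}$, similarly $I_y$. Tensor products act by $((A\otimes B)q)_{\alpha;\beta}=\sum_{\alpha',\beta'}A_{\alpha\alpha'}B_{\beta\beta'}q_{\alpha';\beta'}$. Set $U=(\mathrm{Id}\otimes I_y)u$, $V=(I_x\otimes\mathrm{Id})v$, and for $E=E_{ij}$ $$\Phi^E_{i,s;j,r}=\int_{y_{j,0}}^{y_{j,r}}\big(u_h(x_{i,s},y)-u_h(x_{i,0},y)\big)dy+\int_{x_{i,0}}^{x_{i,s}}\big(v_h(x,y_{j,r})-v_h(x,y_{j,0})\big)dx.$$ The OSS-GFq semi-discretization of linear acoustics $\partial_tu+\partial_xp=0$, $\partial_tv+\partial_yp=0$, $\partial_tp+\partial_xu+\partial_yv=0$ is $\mathcal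 A_C\frac{d}{dt}q+(\mathcal E_{\text{C-GFq}}+\mathcal E_{\text{OSS-GFq}})q=0$, where $\mathcal A_C$ is block diagonal with blocks $M_x\otimes M_y$ and, with a constant stabilization parameter $\alpha$, $$\mathcal E_{\text{C-GFq}}=\begin{pmatrix} 0&0&D_x\otimes M_y \\ 0&0&M_x\otimes D_y \\ {D_x}\otimes(D_yI_y)&(D_xI_x)\otimes D_y&0 \end{pmatrix},$$ $$\mathcal E_{\text{OSS-GFq}}=\alpha h\begin{pmatrix} Z_x\otimes D_yI_y&Z_xI_x\otimes D_y&0 \\ {D_x}\otimes Z_yI_y&D_xI_x\otimes Z_y&0 \\ 0&0&Z_x\otimes M_y+M_x\otimes Z_y \end{pmatrix}.$$ *)

(* Defs.v *)
From HB Require Import structures.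
From mathcomp Require Import all_boot all_order all_algebra.
From mathcomp Require Import all_classical all_reals all_analysis.

Set Implicit Arguments.
Unset Strict Implicit.
Unset Printing Implicit Defensive.

Import Order.TTheory GRing.Theory Num.Theory numFieldNormedType.Exports.
Local Open Scope classical_set_scope.
Local Open Scope ring_scope.

(* Legendre polynomial of degree n shifted to [0,1] (Rodrigues' formula);
   p^`N(n) is the n-th derivative divided by n!. *)
Definition legendre01 (R : realType) (n : nat) : {poly R} :=
  (('X^2 - 'X) ^+ n)^`N(n).

(* The K+1 Gauss-Lobatto points of [0,1]: both end points and the K-1 zeros of
   the derivative of the degree K Legendre polynomial. *)
Definition gauss_lobatto (R : realType) (K : nat) (xi : 'I_K.+1 -> R) : Prop :=
  [/\ xi ord0 = 0, xi ord_max = 1,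
      (forall s r : 'I_K.+1, (s < r)%N -> xi s < xi r) &
      (forall s : 'I_K.+1, (0 < s < K)%N -> root (legendre01 R K)^`() (xi s))].

Definition lagrange01 (R : realType) (K : nat) (xi : 'I_K.+1 -> R)
    (s : 'I_K.+1) : {poly R} :=
  let p := \prod_(r < K.+1 | r != s) ('X - (xi r)%:P) in (p.[xi s]^-1)%:P * p.

(* Interpolatory weights; at the Gauss-Lobatto points they are the
   Gauss-Lobatto weights. *)
Definition weight (R : realType) (K : nat) (xi : 'I_K.+1 -> R)
    (s : 'I_K.+1) : R :=
  \int[lebesgue_measure]_(t in `[0, 1]) (lagrange01 xi s).[t].

Record grid (R : realType) := Grid { ncells : nat; origin : R; step : R }.

Definition grid_wf (R : realType) (g : grid R) : Prop :=
  (0 < ncells g)%N /\ 0 < step g.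

Lemma gidx_proof (N K : nat) (i : 'I_N) (s : 'I_K.+1) :
  (i * K + s < (N * K).+1)%N.
Proof.
rewrite ltnS (leq_trans (n := (i.+1 * K)%N)) ?leq_mul2r ?ltn_ord ?orbT //.
by rewrite mulSn addnC leq_add2r -ltnS ltn_ord.
Qed.

(* Global number i K + s of the local node s of cell i. *)
Definition gidx (N K : nat) (i : 'I_N) (s : 'I_K.+1) : 'I_(N * K).+1 :=
  Ordinal (gidx_proof i s).

Section OneDimension.
Context (R : realType) (K : nat) (xi : 'I_K.+1 -> R) (g : grid R).

Local Notation N := (ncells g).
Local Notation mu := lebesgue_measure.

Definition cell_left (i : nat) : R := origin g + i%:R * step g.

Definition cell (i : nat) : set R := `[cell_left i, cell_left i.+1].

Definition domain : set R := `[cell_left 0, cell_left N].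

Definition lnode (i : nat) (s : 'I_K.+1) : R := cell_left i + xi s * step g.

Definition node (a : 'I_(N * K).+1) : R := lnode (a %/ K) (inord (a %% K)).

(* Restriction of the nodal basis function phi_a to cell i, as a polynomial in
   the physical coordinate; zero if a is not a node of cell i. *)
Definition phi_cell (a : 'I_(N * K).+1) (i : 'I_N) : {poly R} :=
  \sum_(s < K.+1 | gidx i s == a)
    (lagrange01 xi s \Po ((step g)^-1 *: ('X - (cell_left i)%:P))).

(* On a common end point of two cells the choice of the cell is immaterial, see
   phi_cellE; outside of the domain the value is 0 and is never used. *)
Definition phi (a : 'I_(N * K).+1) (x : R) : R :=
  if [pick i : 'I_N | `[< cell i x >]] is Some i then (phi_cell a i).[x] else 0.

(* Cellwise Gauss-Lobatto quadrature of a cellwise polynomial, which may be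
   discontinuous across the cells. *)
Definition quadrature (F : 'I_N -> {poly R}) : R :=
  \sum_(i < N) \sum_(s < K.+1) step g * weight xi s * (F i).[lnode i s].

Definition mass : 'M[R]_((N * K).+1) :=
  \matrix_(a, b) quadrature (fun i => phi_cell a i * phi_cell b i).

(* int phi_a phi_b' *)
Definition diffR : 'M[R]_((N * K).+1) :=
  \matrix_(a, b) quadrature (fun i => phi_cell a i * (phi_cell b i)^`()).

(* int phi_a' phi_b *)
Definition diffL : 'M[R]_((N * K).+1) :=
  \matrix_(a, b) quadrature (fun i => (phi_cell a i)^`() * phi_cell b i).

(* int phi_a' phi_b' *)
Definition stiff : 'M[R]_((N * K).+1) :=
  \matrix_(a, b) quadrature (fun i => (phi_cell a i)^`() * (phi_cell b i)^`()).

(* The mass matrix is diagonal, and invertible because the Gauss-Lobatto weights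
   are positive, so that invmx is its genuine inverse. *)
Definition oss : 'M[R]_((N * K).+1) := stiff - diffL *m invmx mass *m diffR.

Definition interp (w : 'cV[R]_((N * K).+1)) (x : R) : R :=
  \sum_a w a ord0 * phi a x.

(* Matrix of w |-> (int_{x_0}^{x_a} w_h)_a, see integratorE. *)
Definition integrator : 'M[R]_((N * K).+1) :=
  \matrix_(a, b) \int[mu]_(x in `[node ord0, node a]) phi b x.

Section Facts.
Hypotheses (K_gt0 : (0 < K)%N) (xiP : gauss_lobatto xi) (gP : grid_wf g).

Lemma gauss_lobatto_inj : injective xi.
Proof.
case: xiP => _ _ lt_xi _ s r eq_xi; apply/val_inj/eqP => /=.
by case: ltngtP => // /lt_xi; rewrite eq_xi ltxx.
Qed.

Lemma lagrange01_sample s r : (lagrange01 xi s).[xi r] = (s == r)%:R.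
Proof.
rewrite /lagrange01 hornerM hornerC; set p := (\prod_(_ < _ | _) _).
have [<-|neq_sr] := eqVneq s r.
  rewrite mulVf // horner_prod; apply/prodf_neq0 => t neq_ts.
  by rewrite hornerXsubC subr_eq0 (inj_eq gauss_lobatto_inj) eq_sym.
rewrite [X in _ * X]horner_prod (bigD1 r) 1?eq_sym //=.
by rewrite hornerXsubC subrr mul0r mulr0.
Qed.

Lemma size_lagrange01 s : (size (lagrange01 xi s) <= K.+1)%N.
Proof.
rewrite /lagrange01 mul_polyC (leq_trans (size_scale_leq _ _)) //.
rewrite size_prod; last by move=> r _; rewrite polyXsubC_eq0.
rewrite (eq_bigr (fun=> (2 * 1)%N)); last by move=> r _; rewrite size_XsubC.
rewrite -big_distrr /= sum1_card cardC1 card_ord /=.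
by rewrite mul2n -addnn -addSn addnK.
Qed.

Lemma gidx_inj (i : 'I_N) : injective (@gidx N K i).
Proof. by move=> s r /(congr1 val) /= /addnI /val_inj. Qed.

Lemma step_neq0 : step g != 0.
Proof. by case: gP => _ /lt0r_neq0. Qed.

Lemma cell_leftS i : cell_left i.+1 = cell_left i + step g.
Proof. by rewrite /cell_left -natr1 mulrDl mul1r addrA. Qed.

Lemma le_cell_left i j : (cell_left i <= cell_left j) = (i <= j)%N.
Proof. by case: gP => _ h; rewrite /cell_left lerD2l ler_pM2r // ler_nat. Qed.

Lemma lnode0 i : lnode i ord0 = cell_left i.
Proof. by case: xiP => x0 _ _ _; rewrite /lnode x0 mul0r addr0. Qed.

Lemma lnodeK i : lnode i ord_max = cell_left i.+1.
Proof. by case: xiP => _ xK _ _; rewrite /lnode xK mul1r cell_leftS. Qed.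

Lemma cell_lnode i s : cell i (lnode i s).
Proof.
case: xiP => x0 xK lt_xi _; rewrite /cell /= in_itv /= -lnode0 -lnodeK.
case: gP => _ h; rewrite /lnode !lerD2l !ler_pM2r //.
have le_xi : forall r t : 'I_K.+1, (r <= t)%N -> xi r <= xi t.
  by move=> r t; rewrite leq_eqVlt => /predU1P[/val_inj->//|/lt_xi/ltW].
by rewrite !le_xi //= -ltnS.
Qed.

Lemma node_gidx (i : 'I_N) s : node (gidx i s) = lnode i s.
Proof.
rewrite /node /=; have := ltn_ord s; rewrite ltnS leq_eqVlt => /predU1P[sK|sK].
  have -> : s = ord_max by apply/val_inj.
  rewrite /= addnC -mulSn modnMl mulnK // lnodeK -lnode0; congr lnode.
  by apply/val_inj; rewrite /= inordK.
rewrite divnMDl // divn_small // addn0 modnMDl modn_small //; congr lnode.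
by apply/val_inj; rewrite /= inordK // ltnW.
Qed.

Lemma gidx_surj (a : 'I_(N * K).+1) : exists (i : 'I_N) s, a = gidx i s.
Proof.
case: gP => N_gt0 _; have := ltn_ord a; rewrite ltnS leq_eqVlt.
case/predU1P => [aN|ltaN].
  have ltN : (N.-1 < N)%N by rewrite prednK.
  exists (Ordinal ltN), ord_max; apply/val_inj => /=.
  by rewrite aN -[in LHS](prednK N_gt0) mulSn addnC.
have lti : (a %/ K < N)%N by rewrite ltn_divLR.
have lts : (a %% K < K.+1)%N by rewrite ltnW // ltnS ltn_pmod.
exists (Ordinal lti), (Ordinal lts); apply/val_inj => /=.
exact: divn_eq.
Qed.

Lemma size_phi_cell a i : (size (phi_cell a i) <= K.+1)%N.
Proof.
rewrite /phi_cell (leq_trans (size_sum _ _ _)) //; apply/bigmax_leqP => s _.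
rewrite (leq_trans (size_comp_poly_leq _ _)) // ltnS.
rewrite -[X in (_ <= X)%N]muln1 leq_mul // -subn1 leq_subLR.
  by rewrite add1n size_lagrange01.
by rewrite (leq_trans (size_scale_leq _ _)) // size_XsubC.
Qed.

Lemma phi_cell_lnode a (i : 'I_N) s :
  (phi_cell a i).[lnode i s] = (a == gidx i s)%:R.
Proof.
rewrite /phi_cell horner_sum.
have E r : (lagrange01 xi r \Po ((step g)^-1 *: ('X - (cell_left i)%:P))).[lnode i s]
    = (r == s)%:R.
  rewrite horner_comp hornerZ hornerXsubC /lnode addrC addKr mulrC mulfK //.
    exact: lagrange01_sample.
  exact: step_neq0.
under eq_bigr do rewrite E.
have [->|ne] := eqVneq a (gidx i s).
  rewrite (bigD1 s) //= eqxx big1 ?addr0 // => r /andP[_ /negPf ->] //.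
rewrite big1 // => r /eqP ra; case: eqP => // rs.
by rewrite -ra rs eqxx in ne.
Qed.

Lemma phi_cellE a (i : 'I_N) x : cell i x -> phi a x = (phi_cell a i).[x].
Proof.
have main (j k : 'I_N) : (j < k)%N -> cell j x -> cell k x ->
    (phi_cell a j).[x] = (phi_cell a k).[x].
  move=> jk; rewrite /cell /= !in_itv /= => /andP[_ xj] /andP[kx _].
  have jkE : k = j.+1 :> nat.
    by apply/eqP; rewrite eqn_leq jk andbT -le_cell_left (le_trans kx).
  have xE : x = cell_left j.+1 by apply/le_anti; rewrite xj -jkE kx.
  rewrite [in LHS]xE -lnodeK xE -jkE -lnode0 !phi_cell_lnode.
  suff -> : gidx j (@ord_max K) = gidx k ord0 by [].
  by apply/val_inj; rewrite /= jkE mulSn addnC addn0.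
move=> cell_x; rewrite /phi; case: pickP => [k /asboolP xk|/(_ i)]; last first.
  by rewrite asboolT.
have [ki|ik|/val_inj -> //] := ltngtP (k : nat) (i : nat); first exact: main.
by rewrite (main i k).
Qed.

Lemma phi_node a b : phi a (node b) = (a == b)%:R.
Proof.
have [i [s ->]] := gidx_surj b.
by rewrite node_gidx (phi_cellE a (cell_lnode i s)) phi_cell_lnode.
Qed.

Lemma phi_continuous a : {within domain, continuous (phi a)}.
Proof.
suff H n : (n <= N)%N -> {within `[cell_left 0, cell_left n], continuous (phi a)}.
  exact: H.
elim: n => [_|n IHn ltn]; first by rewrite set_itv1; exact: continuous_subspace1.
have -> : `[cell_left 0, cell_left n.+1]%classic =
    `[cell_left 0, cell_left n] `|` cell n.
  apply/seteqP; split=> x /=; rewrite /cell /= !in_itv /=.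
    move=> /andP[-> ->]; have [|/ltW ->] := leP x (cell_left n); first by left.
    by right.
  case=> /andP[l r]; apply/andP; split=> //.
    by rewrite (le_trans r) // le_cell_left.
  by rewrite (le_trans _ l) // le_cell_left.
apply: withinU_continuous; [exact: itv_closed| exact: itv_closed
  | exact: IHn (ltnW ltn) |].
apply: (@subspace_eq_continuous _ (cell n) _
    (horner (phi_cell a (Ordinal ltn)))).
  move=> x; rewrite inE => x_in; apply/esym.
  exact: (@phi_cellE a (Ordinal ltn)).
by apply: continuous_subspaceT; exact: continuous_horner.
Qed.

Lemma node_domain b : domain (node b).
Proof.
have [i [s ->]] := gidx_surj b; have := cell_lnode i s.
rewrite node_gidx /cell /domain /= !in_itv /= => /andP[l r].
by rewrite (le_trans _ l) ?le_cell_left // (le_trans r) // le_cell_left.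
Qed.

Lemma phi_integrable a c d : domain c -> domain d ->
  lebesgue_measure.-integrable `[c, d] (EFin \o phi a).
Proof.
move=> c_in d_in; apply: continuous_compact_integrable.
  exact: segment_compact.
apply: continuous_subspaceW (@phi_continuous a) => x /=.
move: c_in d_in; rewrite /domain /= !in_itv /= => /andP[c0 _] /andP[_ dN] /andP[cx xd].
by rewrite (le_trans c0 cx) (le_trans xd dN).
Qed.

Lemma Rintegral_interp (w : 'cV[R]_((N * K).+1)) c d : domain c -> domain d ->
  \int[mu]_(x in `[c, d]) interp w x =
  \sum_a w a ord0 * \int[mu]_(x in `[c, d]) phi a x.
Proof.
move=> c_in d_in; pose D := `[c, d]%classic.
have mD : measurable D by exact: measurable_itv.
have I a : mu.-integrable D (EFin \o (fun x => w a ord0 * phi a x)).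
  rewrite (_ : _ \o _ = (fun x => (w a ord0)%:E * (phi a x)%:E)%E) //.
  by apply: integrableZl => //; exact: phi_integrable.
rewrite /Rintegral /interp.
under eq_integral do rewrite -sumEFin.
rewrite integral_sum //= -sum_fine; last first.
  by move=> a _; apply: integrable_fin_num => //; exact: I.
apply: eq_bigr => a _; rewrite -/(Rintegral _ _ _) RintegralZl //.
exact: phi_integrable.
Qed.

Lemma integratorE (w : 'cV[R]_((N * K).+1)) a :
  (integrator *m w) a ord0 = \int[mu]_(x in `[node ord0, node a]) interp w x.
Proof.
rewrite Rintegral_interp; [|exact: node_domain..].
by rewrite mxE; apply: eq_bigr => b _; rewrite !mxE mulrC.
Qed.

End Facts.
End OneDimension.

Section TwoDimensions.
Context (R : realType) (K : nat) (xi : 'I_K.+1 -> R) (gx gy : grid R).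

Local Notation Nx := (ncells gx).
Local Notation Ny := (ncells gy).
Local Notation mu := lebesgue_measure.

Definition gridfun := 'M[R]_((Nx * K).+1, (Ny * K).+1).

Definition state := (gridfun * gridfun * gridfun)%type.

Definition interp2 (w : gridfun) (x y : R) : R :=
  \sum_a \sum_b w a b * phi xi a x * phi xi b y.

Definition tens (A : 'M[R]_((Nx * K).+1)) (B : 'M[R]_((Ny * K).+1))
    (q : gridfun) : gridfun :=
  \matrix_(a, b) \sum_a' \sum_b' A a a' * B b b' * q a' b'.

Definition integrated_u (u : gridfun) : gridfun :=
  tens 1%:M (integrator xi gy) u.

Definition integrated_v (v : gridfun) : gridfun :=
  tens (integrator xi gx) 1%:M v.

Definition cell_residual (u v : gridfun) (i : 'I_Nx) (j : 'I_Ny)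
    (s r : 'I_K.+1) : R :=
  \int[mu]_(y in `[lnode xi gy j ord0, lnode xi gy j r])
     (interp2 u (lnode xi gx i s) y - interp2 u (lnode xi gx i ord0) y) +
  \int[mu]_(x in `[lnode xi gx i ord0, lnode xi gx i s])
     (interp2 v x (lnode xi gy j r) - interp2 v x (lnode xi gy j ord0)).

Local Notation Mx := (mass xi gx).
Local Notation My := (mass xi gy).
Local Notation Dx := (diffR xi gx).
Local Notation Dy := (diffR xi gy).
Local Notation Zx := (oss xi gx).
Local Notation Zy := (oss xi gy).
Local Notation Ix := (integrator xi gx).
Local Notation Iy := (integrator xi gy).

Definition E_CGFq (q : state) : state :=
  let: (u, v, p) := q in
  (tens Dx My p,
   tens Mx Dy p,
   tens Dx (Dy *m Iy) u + tens (Dx *m Ix) Dy v).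

Definition E_OSSGFq (alpha : R) (q : state) : state :=
  let: (u, v, p) := q in
  let h := Num.min (step gx) (step gy) in
  ((alpha * h) *: (tens Zx (Dy *m Iy) u + tens (Zx *m Ix) Dy v),
   (alpha * h) *: (tens Dx (Zy *m Iy) u + tens (Dx *m Ix) Zy v),
   (alpha * h) *: (tens Zx My p + tens Mx Zy p)).

End TwoDimensions.

(* Main.v *)
Require Import Defs.
From mathcomp Require Import all_boot all_order all_algebra.
From mathcomp Require Import all_classical all_reals all_analysis.
From mathcomp Require Import ring.

Set Implicit Arguments.
Unset Strict Implicit.
Unset Printing Implicit Defensive.

Import Order.TTheory GRing.Theory Num.Theory numFieldNormedType.Exports.
Local Open Scope ring_scope.

(** The spatial operators see the velocities only through the single grid
    function W = U + V: since (A ⊗ B I_y) u = (A ⊗ B) U and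
    (A I_x ⊗ B) v = (A ⊗ B) V, the pressure row of the central part is
    (D_x ⊗ D_y) W, and the two velocity rows of the stabilization are
    (Z_x ⊗ D_y) W and (D_x ⊗ Z_y) W ([tens_integrated]). Every factor occurring
    here annihilates constant vectors: the nodal basis is a partition of unity
    on each cell, so the discrete derivatives of a constant vanish under any
    quadrature ([diffR_const], [oss_const]). On f_a + g_b each term is constant
    in one direction and is killed by the factor acting in that direction
    ([tens_separable]). A constant pressure is killed for the same reason, as
    each operator acting on p has a factor D or Z.

    For the equivalence, additivity of the integral turns the cell residual into
    the mixed second difference of W between the node (i,s; j,r) and the corner
    (i,0; j,0) of its cell ([cell_residualE]). Such differences vanish when W
    separates. Conversely, neighbouring cells share their interface nodes, so a
    nodal array that is constant on each cell is globally constant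
    ([const_on_cells]); applied once per direction, this propagates the
    vanishing from the cells to the whole grid ([separable_of_mixed_diff]). *)

(** * One-dimensional operators *)

Section OneDimension.
Context (R : realType) (K : nat) (xi : 'I_K.+1 -> R) (g : grid R).
Hypotheses (K_gt0 : (0 < K)%N) (xiP : gauss_lobatto xi) (gP : grid_wf g).

Local Notation N := (ncells g).
Local Notation ones := (const_mx 1 : 'cV[R]_((N * K).+1)).

(** The left node of cell i + 1 is the right node of cell i, which lets the
    constant value pass from one cell to the next. *)
Lemma const_on_cells (T : Type) (F : 'I_(N * K).+1 -> T) :
  (forall (i : 'I_N) (s : 'I_K.+1), F (gidx i s) = F (gidx i ord0)) ->
  forall a, F a = F ord0.
Proof.
move=> const_cell a; have [i [s ->]] := gidx_surj K_gt0 gP a.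
rewrite const_cell {s a}; case: i; elim=> [|i IHi] lt_iN.
  by congr F; apply/val_inj.
rewrite -(IHi (ltnW lt_iN)) -[RHS](const_cell _ ord_max); congr F.
by apply/val_inj; rewrite /= mulSn addn0 addnC.
Qed.

(** Both sides have degree at most K and agree at the K + 1 nodes of the
    cell. *)
Lemma sum_phi_cell (i : 'I_N) : \sum_a phi_cell xi a i = 1.
Proof.
apply/eqP; rewrite -subr_eq0; apply/eqP.
pose nodes := [seq lnode xi g i s | s <- enum 'I_K.+1].
apply: (@roots_geq_poly_eq0 _ _ nodes).
- apply/allP => _ /mapP[s _ ->]; rewrite /root hornerD hornerN hornerC.
  rewrite horner_sum (bigD1 (gidx i s)) //= phi_cell_lnode // eqxx big1.
    by rewrite addr0 subrr.
  by move=> a /negPf ne_a; rewrite phi_cell_lnode // ne_a.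
- rewrite map_inj_uniq ?enum_uniq // => s r /addrI.
  by move/(mulIf (step_neq0 gP))/(gauss_lobatto_inj xiP).
- rewrite size_map size_enum_ord (leq_trans (size_polyD _ _)) // geq_max.
  rewrite size_polyN size_poly1 andbT (leq_trans (size_sum _ _ _)) //.
  by apply/bigmax_leqP => a _; exact: size_phi_cell.
Qed.

Lemma quadrature_sum_deriv (F : 'I_N -> {poly R}) :
  \sum_b quadrature xi (fun i => F i * (phi_cell xi b i)^`()) = 0.
Proof.
rewrite /quadrature exchange_big big1 //= => i _.
rewrite exchange_big big1 //= => s _.
rewrite -mulr_sumr -horner_sum -mulr_sumr.
have -> : \sum_b (phi_cell xi b i)^`() = (\sum_b phi_cell xi b i)^`().
  by rewrite raddf_sum.
by rewrite sum_phi_cell derivC mulr0 horner0 mulr0.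
Qed.

Lemma diffR_const : diffR xi g *m ones = 0.
Proof.
apply/matrixP => a k; rewrite !mxE.
rewrite -[RHS](quadrature_sum_deriv (phi_cell xi a)).
by apply: eq_bigr => b _; rewrite !mxE mulr1.
Qed.

Lemma stiff_const : stiff xi g *m ones = 0.
Proof.
apply/matrixP => a k; rewrite !mxE.
rewrite -[RHS](quadrature_sum_deriv (fun i => (phi_cell xi a i)^`())).
by apply: eq_bigr => b _; rewrite !mxE mulr1.
Qed.

(** Both terms of Z = stiff - diffL mass^-1 diffR differentiate their argument
    first. *)
Lemma oss_const : oss xi g *m ones = 0.
Proof. by rewrite mulmxBl stiff_const -!mulmxA diffR_const !mulmx0 subrr. Qed.

Lemma Rintegral_itv_cat (f : R -> R) (a b c : R) : a <= b -> b <= c ->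
  lebesgue_measure.-integrable `[a, c]%classic (EFin \o f) ->
  \int[lebesgue_measure]_(t in `[b, c]) f t =
  \int[lebesgue_measure]_(t in `[a, c]) f t
  - \int[lebesgue_measure]_(t in `[a, b]) f t.
Proof.
move=> ab bc int_f; rewrite Rintegral_itvB ?bnd_simp //.
rewrite Rintegral_itv_obnd_cbnd //; apply: integrableS int_f => //.
by move=> t /=; rewrite !in_itv /= => /andP[/ltW bt ->]; rewrite (le_trans ab).
Qed.

Lemma integrator_cell (w : 'cV[R]_((N * K).+1)) (i : 'I_N) (s : 'I_K.+1) :
  \int[lebesgue_measure]_(x in `[lnode xi g i ord0, lnode xi g i s])
    interp xi w x =
  (integrator xi g *m w) (gidx i s) ord0
  - (integrator xi g *m w) (gidx i ord0) ord0.
Proof.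
have n0E : node xi (ord0 : 'I_(N * K).+1) = cell_left g 0.
  rewrite /node div0n mod0n -(lnode0 g xiP); congr lnode.
  by apply/val_inj; rewrite /= inordK.
have dom t : domain g (lnode xi g i t).
  by rewrite -node_gidx //; exact: node_domain.
have dom0 : domain g (cell_left g 0) by rewrite -n0E; exact: node_domain.
have le0 : cell_left g 0 <= lnode xi g i ord0 by rewrite lnode0 // le_cell_left.
have le1 : lnode xi g i ord0 <= lnode xi g i s.
  by have := cell_lnode xiP gP i s; rewrite /cell /= in_itv /= lnode0 // => /andP[].
rewrite Rintegral_interp // !mxE -sumrB; apply: eq_bigr => a _.
rewrite !mxE !node_gidx // n0E -mulrBl mulrC; congr (_ * _).
by apply: Rintegral_itv_cat => //; exact: phi_integrable.
Qed.

Lemma interpB (w1 w2 : 'cV[R]_((N * K).+1)) (x : R) :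
  interp xi w1 x - interp xi w2 x = interp xi (w1 - w2) x.
Proof.
by rewrite /interp -sumrB; apply: eq_bigr => a _; rewrite !mxE mulrBl.
Qed.

Lemma interp_node (w : 'cV[R]_((N * K).+1)) (i : 'I_N) (s : 'I_K.+1) :
  interp xi w (lnode xi g i s) = w (gidx i s) ord0.
Proof.
rewrite -node_gidx // /interp (bigD1 (gidx i s)) //= phi_node // eqxx mulr1.
by rewrite big1 ?addr0 // => a /negPf ne_a; rewrite phi_node // ne_a mulr0.
Qed.

End OneDimension.

(** * Tensor products *)

Section TwoDimensions.
Context (R : realType) (K : nat) (xi : 'I_K.+1 -> R) (gx gy : grid R).

Local Notation nx := (ncells gx * K).+1.
Local Notation ny := (ncells gy * K).+1.
Local Notation gridfun := (gridfun K gx gy).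

Lemma tensE (A : 'M[R]_nx) (B : 'M[R]_ny) (q : gridfun) :
  tens A B q = A *m q *m B^T.
Proof.
apply/matrixP => a b; rewrite !mxE exchange_big; apply: eq_bigr => b' _ /=.
by rewrite !mxE mulr_suml; apply: eq_bigr => a' _; rewrite mulrAC.
Qed.

Lemma tens_integrated (A : 'M[R]_nx) (B : 'M[R]_ny) (u v : gridfun) :
  tens A (B *m integrator xi gy) u + tens (A *m integrator xi gx) B v =
  tens A B (integrated_u xi u + integrated_v xi v).
Proof.
rewrite /integrated_u /integrated_v !tensE mul1mx trmx1 mulmx1 trmx_mul.
by rewrite mulmxDr mulmxDl !mulmxA.
Qed.

(** An array f_a + g_b is the sum of the rank-one matrices f 1^T and 1 g^T; B
    annihilates the first and A the second. *)
Lemma tens_separable (A : 'M[R]_nx) (B : 'M[R]_ny) (w : gridfun) f g :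
  A *m (const_mx 1 : 'cV_nx) = 0 -> B *m (const_mx 1 : 'cV_ny) = 0 ->
  (forall a b, w a b = f a + g b) -> tens A B w = 0.
Proof.
move=> A1 B1 wE.
have -> : w = (\col_a f a) *m (const_mx 1 : 'cV_ny)^T
              + (const_mx 1 : 'cV_nx) *m (\row_b g b).
  by apply/matrixP => a b; rewrite !mxE !big_ord1 !mxE mulr1 mul1r wE.
rewrite tensE mulmxDr mulmxDl -!mulmxA -trmx_mul B1 trmx0 !mulmx0 add0r.
by rewrite mulmxA A1 mul0mx.
Qed.

Lemma tens_const (A : 'M[R]_nx) (B : 'M[R]_ny) (p : gridfun) (c : R) :
  (forall a b, p a b = c) ->
  A *m (const_mx 1 : 'cV_nx) = 0 \/ B *m (const_mx 1 : 'cV_ny) = 0 ->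
  tens A B p = 0.
Proof.
move=> pc; have -> : p = c *: ((const_mx 1 : 'cV_nx) *m (const_mx 1 : 'cV_ny)^T).
  by apply/matrixP => a b; rewrite pc !mxE big_ord1 !mxE !mulr1.
rewrite tensE -scalemxAr -scalemxAl -!mulmxA -trmx_mul.
case=> [A1 | B1]; first by rewrite mulmxA A1 mul0mx scaler0.
by rewrite B1 trmx0 !mulmx0 scaler0.
Qed.

(** * Cell residuals *)

Hypotheses (K_gt0 : (0 < K)%N) (xiP : gauss_lobatto xi).
Hypotheses (gxP : grid_wf gx) (gyP : grid_wf gy).

Definition mixed_diff (w : gridfun) (a a' : 'I_nx) (b b' : 'I_ny) : R :=
  w a b - w a' b - w a b' + w a' b'.

Lemma separable_mixed_diff (w : gridfun) f g a a' b b' :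
  (forall a b, w a b = f a + g b) -> mixed_diff w a a' b b' = 0.
Proof. by move=> wE; rewrite /mixed_diff !wE; ring. Qed.

(** The hypothesis makes b |-> w(i,s; b) - w(i,0; b) constant on each cell in
    y, hence on the whole grid; this makes a |-> w(a; b) - w(a; 0) constant on
    each cell in x, hence on the whole grid. *)
Lemma separable_of_mixed_diff (w : gridfun) :
  (forall i j s r,
     mixed_diff w (gidx i s) (gidx i ord0) (gidx j r) (gidx j ord0) = 0) ->
  forall a b, w a b = w a ord0 + (w ord0 b - w ord0 ord0).
Proof.
move=> mixed0 a b.
have const_y (i : 'I_(ncells gx)) s b' :
    w (gidx i s) b' - w (gidx i ord0) b'
    = w (gidx i s) ord0 - w (gidx i ord0) ord0.
  apply: (const_on_cells K_gt0 gyP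
    (F := fun b => w (gidx i s) b - w (gidx i ord0) b)) => j r.
  by apply/eqP; rewrite -subr_eq0 -(mixed0 i j s r) /mixed_diff; apply/eqP; ring.
have const_x : w a b - w a ord0 = w ord0 b - w ord0 ord0.
  apply: (const_on_cells K_gt0 gxP (F := fun a => w a b - w a ord0)) => i s.
  have /eqP := const_y i s b; rewrite -subr_eq0 => /eqP diff0.
  by apply/eqP; rewrite -subr_eq0 -diff0; apply/eqP; ring.
by rewrite -const_x; ring.
Qed.

Lemma interp2_nodel (w : gridfun) (i : 'I_(ncells gx)) s (y : R) :
  interp2 xi w (lnode xi gx i s) y = interp xi (row (gidx i s) w)^T y.
Proof.
rewrite /interp2 exchange_big; apply: eq_bigr => b _ /=.
rewrite -mulr_suml !mxE; congr (_ * _).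
have <- : col b w (gidx i s) ord0 = w (gidx i s) b by rewrite mxE.
by rewrite -(interp_node K_gt0 xiP gxP); apply: eq_bigr => a _; rewrite !mxE.
Qed.

Lemma interp2_noder (w : gridfun) (j : 'I_(ncells gy)) r (x : R) :
  interp2 xi w x (lnode xi gy j r) = interp xi (col (gidx j r) w) x.
Proof.
apply: eq_bigr => a _; rewrite !mxE.
under eq_bigr do rewrite mulrAC.
rewrite -mulr_suml; congr (_ * _).
have <- : (row a w)^T (gidx j r) ord0 = w a (gidx j r) by rewrite !mxE.
by rewrite -(interp_node K_gt0 xiP gyP); apply: eq_bigr => b _; rewrite !mxE.
Qed.

Lemma integrated_uE (u : gridfun) a b :
  integrated_u xi u a b = (integrator xi gy *m (row a u)^T) b ord0.
Proof.
rewrite /integrated_u tensE mul1mx !mxE; apply: eq_bigr => b' _.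
by rewrite !mxE mulrC.
Qed.

Lemma integrated_vE (v : gridfun) a b :
  integrated_v xi v a b = (integrator xi gx *m col b v) a ord0.
Proof.
rewrite /integrated_v tensE trmx1 mulmx1 !mxE; apply: eq_bigr => a' _.
by rewrite !mxE.
Qed.

(** The two integrands of the residual are interpolants of one-dimensional
    arrays, so integrating them over part of a cell gives differences of U in y
    and of V in x, each already a difference in the other direction. *)
Lemma cell_residualE (u v : gridfun) i j s r :
  cell_residual xi u v i j s r =
  mixed_diff (integrated_u xi u + integrated_v xi v)
    (gidx i s) (gidx i ord0) (gidx j r) (gidx j ord0).
Proof.
rewrite /cell_residual.
have -> : (fun y => interp2 xi u (lnode xi gx i s) y
                    - interp2 xi u (lnode xi gx i ord0) y)
    = interp xi ((row (gidx i s) u)^T - (row (gidx i ord0) u)^T).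
  by apply/funext => y; rewrite !interp2_nodel interpB.
have -> : (fun x => interp2 xi v x (lnode xi gy j r)
                    - interp2 xi v x (lnode xi gy j ord0))
    = interp xi (col (gidx j r) v - col (gidx j ord0) v).
  by apply/funext => x; rewrite !interp2_noder interpB.
rewrite !integrator_cell // !mulmxBr /mixed_diff.
have subE n (A B : 'cV[R]_n) k : (A - B) k ord0 = A k ord0 - B k ord0.
  by rewrite !mxE.
have addE (A B : gridfun) a b : (A + B) a b = A a b + B a b by rewrite mxE.
by rewrite !subE !addE !integrated_uE !integrated_vE; ring.
Qed.

End TwoDimensions.

(** * Steady states *)

Theorem proposition5p2 (R : realType) (K : nat) (K_gt0 : (0 < K)%N)
    (xi : 'I_K.+1 -> R) (xiP : gauss_lobatto xi)
    (gx gy : grid R) (gxP : grid_wf gx) (gyP : grid_wf gy)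
    (alpha : R) (u v p : gridfun K gx gy)
    (p_const : exists c : R, forall a b, p a b = c) :
  let U := integrated_u xi u in
  let V := integrated_v xi v in
  let separable := exists (f : 'I_(ncells gx * K).+1 -> R)
                          (g : 'I_(ncells gy * K).+1 -> R),
                     forall a b, U a b + V a b = f a + g b in
  let residual_free := forall i j s r, cell_residual xi u v i j s r = 0 in
  (separable <-> residual_free) /\
  (separable \/ residual_free ->
   E_CGFq xi (u, v, p) + E_OSSGFq xi alpha (u, v, p) = 0).
Proof.
move=> U V separable residual_free; pose W := U + V.
have WE a b : W a b = U a b + V a b by rewrite mxE.
have equiv : separable <-> residual_free.
  split=> [[f [g fgE]] i j s r | res0].
    rewrite cell_residualE //; apply: (@separable_mixed_diff _ _ _ _ _ f g).
    by move=> a b; rewrite WE.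
  exists (fun a => W a ord0), (fun b => W ord0 b - W ord0 ord0) => a b.
  rewrite -WE; apply: separable_of_mixed_diff => // i j s r.
  by rewrite -cell_residualE.
split=> // sep_or_res.
have [f [g fgE]] : separable by case: sep_or_res => // /equiv.
have W_sep a b : W a b = f a + g b by rewrite WE.
have [c pc] := p_const.
have Dx := diffR_const xiP gxP; have Dy := diffR_const xiP gyP.
have Zx := oss_const xiP gxP; have Zy := oss_const xiP gyP.
rewrite /E_CGFq /E_OSSGFq !tens_integrated.
rewrite !(tens_separable _ _ W_sep) //.
rewrite !(tens_const pc); try by [left | right].
by rewrite !addr0 !scaler0; congr (_, _, _); rewrite addr0.
Qed.
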